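(* Let $n$ be a positive integer and let $a_0,a_1,\ldots,a_{n-1}$ be a permutation of $\mathbb{Z}_n=\{0,1,\ldots,n-1\}$. For each $i\in\mathbb{Z}_n$ let $k_i,j_i$ be positive integers and define $$N_i=\{i,i+1,\ldots,i+k_i-1\},\qquad A_i=\{a_i,a_{i+1},\ldots,a_{i+j_i-1}\},$$ where the elements of $N_i$ and the indices in $A_i$ are taken modulo $n$. Suppose that $|N_i|\ge 3$ and $|A_i|\ge 3$ for every $i\in\mathbb{Z}_n\setminus\{0\}$, and that $|N_0|\ge 2$ and $|A_0|\ge 2$. Then there exists a partition $\{B,R\}$ of $\mathbb{Z}_n$ such that for every $i\in\mathbb{Z}_n$ we have $N_i\not\subseteq B$ and $A_i\not\subseteq R$.
   Context: $\mathbb{Z}_n$ denotes the set of integers $\{0,1,\ldots,n-1\}$ with addition and multiplication taken modulo $n$. *)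

(* Defs.v *)
From mathcomp Require Import all_boot all_fingroup.
Set Implicit Arguments.
Unset Strict Implicit.
Unset Printing Implicit Defensive.

(* The ring Z_n is carried by 'I_n and not by MathComp's 'Z_n, which denotes
   Z_2 when n = 1. *)
Definition zn_shift (n : nat) (i : 'I_n) (t : nat) : 'I_n :=
  Ordinal (ltn_pmod (i + t) (leq_ltn_trans (leq0n i) (ltn_ord i))).

(* Both are sets of residues: repetitions that occur for k > n or j > n do not
   count towards the cardinality. *)
Definition Nset (n : nat) (k : nat) (i : 'I_n) : {set 'I_n} :=
  [set zn_shift i t | t : 'I_k].

Definition Aset (n : nat) (a : {perm 'I_n}) (j : nat) (i : 'I_n) :
  {set 'I_n} :=
  [set a (zn_shift i t) | t : 'I_j].

(* Main.v *)
(* It suffices to color Z_n blue and red so that no window {i,i+1,i+2} nor {0,1}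
   is all blue, and no window of the a_i is all red.  The union of a matching of
   consecutive residues and a matching of consecutive a_i is bipartite, and a
   proper 2-coloring of it handles every window that contains an edge.  For n
   even both matchings can be perfect and nothing else is needed.

   For n odd the first matching M_x misses one even x >= 2, and the only window
   at risk is {x-1,x,x+1}; the second one misses a_{n-1}, and its only window at
   risk contains a_0.  Drop the edge {a_0,a_1} and color a_0 blue; it remains to
   color red some y in {x-1,x,x+1}, which is possible as soon as a union D of
   components separates y from a_0.  Let D be the component of n-1 for
   x = n-1.  If a_0 is not in D, take y = n-1.  Otherwise D is a path from n-1 to
   a_0, so it misses a_1.  If D contained x-1, x, x+1 for every x for which it is
   closed under M_x, it would remain closed when x moves to x-2, hence for every
   x, and thus D would contain all of Z_n. *)
Require Import Defs.
From mathcomp Require Import all_boot all_fingroup.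
From mathcomp Require Import zify.

Set Implicit Arguments.
Unset Strict Implicit.
Unset Printing Implicit Defensive.

(** * Two matchings as involutions: 2-colorings and components *)

Lemma iter_conj_involutions (T : Type) (f g : T -> T) (k : nat) (v : T) :
  involutive f -> involutive g ->
  iter k (f \o g) (f (iter k (f \o g) v)) = f v.
Proof.
move=> fK gK; elim: k => // k IHk.
by rewrite iterSr iterS /= fK gK.
Qed.

Lemma iter_inj (T : Type) (h : T -> T) (k : nat) :
  injective h -> injective (iter k h).
Proof. by move=> h_inj; elim: k => //= k IHk u v /h_inj/IHk. Qed.

(** Each component consists of two orbits of [f \o g], exchanged by [f] and by [g]; the one whose
    root has the smaller rank gets color true. *)
Lemma bipartite_fixpoint_free (T : finType) (f g : T -> T) :
  involutive f -> involutive g ->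
  (forall v, f v != v) -> (forall v, g v != v) ->
  exists c : T -> bool,
    (forall v, c (f v) != c v) /\ (forall v, c (g v) != c v).
Proof.
move=> fK gK f_free g_free; pose h := f \o g.
have h_inj : injective h by exact: inj_comp (inv_inj fK) (inv_inj gK).
have hC := fconnect_sym h_inj.
have hf k v : iter k h (f (iter k h v)) = f v := iter_conj_involutions k v fK gK.
(* An orbit of h stable under f would contain a fixed point of f or of g,
   according to the parity of the exponent k below. *)
have orbit_move v : ~~ fconnect h v (f v).
  apply/negP => /iter_findex; set k := findex _ _ _ => fvE.
  have [k_odd|k_even] := boolP (odd k).
    have E : f (g (iter k./2 h v)) = f (iter k./2 h v).
      apply: (@iter_inj _ h k./2 h_inj); rewrite hf -fvE -[f (g _)]/(h _).
      by rewrite -iterS -iterD; congr iter; lia.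
    by have /eqP := inv_inj fK E; rewrite (negPf (g_free _)).
  have /eqP : f (iter k./2 h v) = iter k./2 h v.
    by apply: (@iter_inj _ h k./2 h_inj); rewrite hf -fvE -iterD; congr iter; lia.
  by rewrite (negPf (f_free _)).
have rootP u v : (root (frel h) u == root (frel h) v) = fconnect h u v.
  exact: root_connect.
pose rk v := enum_rank (root (frel h) v).
have rk_eq u v : fconnect h u v -> rk u = rk v.
  by move=> uv; congr enum_rank; apply/eqP; rewrite rootP.
have rk_gf v : rk (g v) = rk (f v).
  apply: rk_eq; apply/connect1/eqP.
  by rewrite /h /= gK.
have rk_f v : rk v != rk (f v).
  by apply/eqP => /enum_rank_inj/eqP; rewrite rootP; apply/negP.
exists (fun v => rk v < rk (f v)).
have swap v : (rk (f v) < rk v) != (rk v < rk (f v)).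
  by have := rk_f v; rewrite -val_eqE /=; case: ltngtP.
split=> v; first by rewrite fK.
have -> : rk (f (g v)) = rk v by apply: rk_eq; rewrite hC; exact: fconnect1.
by rewrite rk_gf.
Qed.

Lemma bipartite_involutions (T : finType) (f g : T -> T) :
  involutive f -> involutive g ->
  exists c : T -> bool,
    (forall v, f v != v -> c (f v) != c v) /\
    (forall v, g v != v -> c (g v) != c v).
Proof.
(* Two copies of the graph, glued along the fixed points. *)
move=> fK gK.
pose dbl (e : T -> T) (p : T * bool) := (e p.1, p.2 (+) (e p.1 == p.1)).
have dblK e : involutive e -> involutive (dbl e).
  by move=> eK [v b]; rewrite /dbl /= eK [v == _]eq_sym -addbA addbb addbF.
have dbl_free e p : dbl e p != p.
  case: p => v b; rewrite /dbl xpair_eqE /=.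
  by case: (e v == v); case: b.
have [c [cf cg]] := bipartite_fixpoint_free (dblK _ fK) (dblK _ gK)
  (dbl_free f) (dbl_free g).
exists (fun v => c (v, false)); split=> v /negPf ev.
  by have := cf (v, false); rewrite /dbl /= ev.
by have := cg (v, false); rewrite /dbl /= ev.
Qed.

(* The union of two matchings is made of paths and even cycles: a component
   with a vertex missed by f has only one vertex missed by g. *)
Lemma dihedral_orbit_fixpoint (T : finType) (f g : T -> T) (x u v : T) :
  involutive f -> involutive g -> f x = x -> g u = u -> g v = v ->
  fconnect (f \o g) x u -> fconnect (f \o g) x v -> u = v.
Proof.
move=> fK gK fx gu gv; pose h := f \o g.
have period w : g w = w -> forall k, iter k h x = w -> iter k.*2.+1 h x = x.
  move=> gw k kw; rewrite -[RHS]fx -[RHS](iter_conj_involutions k x fK gK).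
  rewrite -/h kw -[in f w]gw -[f (g w)]/(h w) -kw -iterS -iterD.
  by congr (iter _ h x); lia.
have fix_iter p q : iter p h x = x -> iter (q * p) h x = x.
  by move=> px; elim: q => // q IHq; rewrite mulSn iterD IHq.
have h_inj : injective h by exact: inj_comp (inv_inj fK) (inv_inj gK).
wlog: u v gu gv / findex h x u <= findex h x v.
  by move=> W xu xv; case/orP: (leq_total (findex h x u) (findex h x v)) => /W;
    [|move=> W'; symmetry; move: W'] => ->.
set k := findex h x u; set l := findex h x v => kl xu xv.
have ku : iter k h x = u := iter_findex xu.
have lv : iter l h x = v := iter_findex xv.
(* [x] has the periods 2k+1 and 2l+1, hence 2(l-k), and then l-k because 2k+1 is odd. *)
have pk := period _ gu _ ku; have pl := period _ gv _ lv.
have p2 : iter (l - k).*2 h x = x.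
  have E : l.*2.+1 = (l - k).*2 + k.*2.+1 by lia.
  by move: pl; rewrite E iterD pk.
have p1 : iter (l - k) h x = x.
  have := fix_iter _ (l - k) pk.
  have -> : (l - k) * k.*2.+1 = (l - k) + k * (l - k).*2 by nia.
  by rewrite iterD fix_iter.
by rewrite -ku -lv -[in LHS]p1 -iterD subnKC.
Qed.

(** Conjugation by [f] inverts [f \o g], and [f] fixes [x]; so [f] reverses the orbit of [x], which
    is thus a whole component. *)
Lemma dihedral_orbit_closed (T : finType) (f g : T -> T) (x : T) :
  involutive f -> involutive g -> f x = x ->
  (forall v, fconnect (f \o g) x (f v) = fconnect (f \o g) x v) /\
  (forall v, fconnect (f \o g) x (g v) = fconnect (f \o g) x v).
Proof.
move=> fK gK fx; pose h := f \o g.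
have h_inj : injective h by exact: inj_comp (inv_inj fK) (inv_inj gK).
have hC := fconnect_sym h_inj.
have fS v : fconnect h x v -> fconnect h x (f v).
  move=> /iter_findex; set k := findex _ _ _ => kv.
  rewrite hC -[X in fconnect _ _ X]fx.
  rewrite -[f x](iter_conj_involutions k x fK gK) -/h kv; exact: fconnect_iter.
have fE v : fconnect h x (f v) = fconnect h x v.
  by apply/idP/idP => /fS; rewrite ?fK.
split=> // v; rewrite -fE -[f (g v)]/(h v).
by rewrite [LHS]hC [RHS]hC -same_fconnect1.
Qed.

(** * Matchings of consecutive residues *)

(* The matching {0,1}, ..., {x-2,x-1}, {x+1,x+2}, ... of the naturals, which
   misses only x, for x even. *)
Definition partner (x i : nat) : nat :=
  if i == x then x else if odd i == (i < x) then i.-1 else i.+1.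

Definition mate (n x : nat) (i : 'I_n) : 'I_n := insubd i (partner x i).

(* The value x = n stands for the perfect matching available when n is even. *)
Definition admissible (n x : nat) : bool :=
  [&& ~~ odd x, 0 < x, x <= n & (x == n) || odd n].

Lemma mateE (n x : nat) (i : 'I_n) :
  admissible n x -> mate x i = partner x i :> nat.
Proof.
case: i => i /= lt_in; rewrite /admissible /mate => adm.
by rewrite val_insubd /= ifT // /partner; case: ifP => ?; [|case: ifP => ?]; lia.
Qed.

Lemma mateK (n x : nat) : admissible n x -> involutive (@mate n x).
Proof.
move=> adm i; apply: val_inj; rewrite /= !(mateE _ adm) /partner.
move: adm; rewrite /admissible; case: i => i /= _.
case: (ltngtP i x) => [ix|ix|->]; last by rewrite eqxx.
  by case: (boolP (odd i)) => oi /=; case: ifP => ?; try case: ifP => ?; lia.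
by case: (boolP (odd i)) => oi /=; case: ifP => ?; try case: ifP => ?; lia.
Qed.

Lemma mate_fix (n x : nat) (i : 'I_n) :
  admissible n x -> (mate x i == i) = (i == x :> nat).
Proof.
move=> adm; rewrite -val_eqE /= mateE // /partner.
move: adm; rewrite /admissible; case: i => i /= _.
by case: ifP => ?; [|case: ifP => ?]; lia.
Qed.

(** [P] is the color to be hit. Every window contains an edge, {0,1} being one itself, except
    {x-1,x,x+1}, which has its own hypothesis. *)
Lemma windows_hit (n x : nat) (P : pred 'I_n) :
  2 < n -> admissible n x ->
  (forall v : 'I_n, nat_of_ord v != x -> P v || P (mate x v)) ->
  (x < n -> exists i : 'I_n,
    i.+1 = x /\ exists2 t, t < 3 & P (zn_shift i t)) ->
  forall i : 'I_n, exists2 t, t < 2 + (nat_of_ord i != 0) & P (zn_shift i t).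
Proof.
move=> n2 adm Ppair Px i.
have pair_hit s : s.+1 < 2 + (nat_of_ord i != 0) ->
    zn_shift i s != x :> nat ->
    partner x (zn_shift i s) = zn_shift i s.+1 :> nat ->
    exists2 t, t < 2 + (nat_of_ord i != 0) & P (zn_shift i t).
  move=> lts sx E; case/orP: (Ppair _ sx) => H; first by exists s => //; lia.
  exists s.+1 => //; suff <- : mate x (zn_shift i s) = zn_shift i s.+1 by [].
  by apply: val_inj; rewrite /= mateE.
have ltin := ltn_ord i.
have shiftE t : t < n ->
    zn_shift i t = (if i + t < n then i + t else i + t - n) :> nat.
  move=> lt_tn /=; case: ltnP => [/modn_small //|n_le].
  by rewrite -[in LHS](subnK n_le) modnDr modn_small //; lia.
have s0 := shiftE 0 (ltnW (ltnW n2)).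
have s1 := shiftE 1 (ltnW n2).
have s2 := shiftE 2 n2.
have [[xn ix]|nix] : x < n /\ i.+1 = x \/ ~ (x < n /\ i.+1 = x) by lia.
  case: (Px xn) => i' [ix' [t t3 Pt]]; exists t.
    by move: adm; rewrite /admissible; lia.
  by have -> : i = i' by apply: val_inj => /=; lia.
move: adm; rewrite /admissible => adm.
(* If [i] is missed or matched with i-1, the edge {i+1,i+2} is used; otherwise {i,i+1}, as for i =
   0. *)
have [i1|i0] := boolP ((odd i == (i < x)) || (i == x :> nat)).
  apply: (pair_hit 1); rewrite ?s1 ?s2; first by lia.
    by case: ifP; lia.
  by rewrite /partner; do 2 case: (ltnP (i + _) n) => ?; case: ifP => ?;
    try case: ifP => ?; lia.
apply: (pair_hit 0); rewrite ?s0 ?s1; first by lia.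
  by case: ifP; lia.
by rewrite /partner; do 2 case: (ltnP (i + _) n) => ?; case: ifP => ?;
  try case: ifP => ?; lia.
Qed.

(** * Separating two vertices by a union of components *)

Lemma separating_coloring (T : finType) (f g : T -> T) (D : pred T) (u y : T) :
  involutive f -> involutive g ->
  (forall v, D (f v) = D v) -> (forall v, D (g v) = D v) -> D u != D y ->
  exists c : pred T,
    [/\ c u, ~~ c y, forall v, f v != v -> c (f v) != c v
      & forall v, g v != v -> c (g v) != c v].
Proof.
move=> fK gK Df Dg uy; have [c [cf cg]] := bipartite_involutions fK gK.
(* Recoloring whole components keeps the coloring proper; the two shifts make [u] true and [y]
   false. *)
exists (fun v => c v (+) (if D v == D u then ~~ c u else c y)).
rewrite eqxx addbN addbb eq_sym (negPf uy) addbb; split=> // v.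
  by move/cf; rewrite Df; case: (if _ then _ else _) (c v) (c _) => [] [] [].
by move/cg; rewrite Dg; case: (if _ then _ else _) (c v) (c _) => [] [] [].
Qed.

(** The window at risk when [x] is missed; for 0 < x < n only x+1 can wrap around. *)
Definition near (n x y : nat) : bool := [|| y.+1 == x, y == x | y == x.+1 %% n].

Lemma near_below (n x y : nat) : x.-1 <= y <= x -> near n x y.
Proof. by move=> yx; rewrite /near orbA; apply/orP; left; lia. Qed.

Lemma near_shift (n x : nat) (y : 'I_n) :
  0 < x < n -> near n x y ->
  exists i : 'I_n, i.+1 = x /\ exists2 t, t < 3 & y = zn_shift i t.
Proof.
move=> /andP[x0 xn]; have ltx : x.-1 < n by lia.
rewrite /near => yx; exists (Ordinal ltx); split; first by rewrite /= prednK.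
case/or3P: yx => /eqP yE; [exists 0 | exists 1 | exists 2] => //; apply: val_inj.
- by rewrite /= addn0 modn_small // -yE.
- by rewrite /= addn1 prednK // modn_small.
by rewrite /= yE; congr (_ %% _); lia.
Qed.

(* Moving the vertex missed by the matching from x to x - 2 only rearranges
   the block {x-2, x-1, x}. *)
Lemma mate_shift_closed (n x : nat) (D : pred 'I_n) :
  admissible n x -> 2 < x < n -> (forall v, D (mate x v) = D v) ->
  (forall v : 'I_n, near n x v -> D v) ->
  forall v, D (mate (x - 2) v) = D v.
Proof.
move=> adm /andP[x2 xn] Dx Dnear.
have adm' : admissible n (x - 2) by move: adm; rewrite /admissible; lia.
have block (v : 'I_n) : x - 2 <= v <= x -> D v.
  (* The vertex x-2 lies outside the window, but its partner x-1 lies in it. *)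
  move=> vx; have [vE|vE] := eqVneq (nat_of_ord v) (x - 2); last first.
    by apply: Dnear; apply: near_below; lia.
  rewrite -Dx; apply: Dnear; apply: near_below; rewrite mateE // /partner vE.
  by move: adm; rewrite /admissible; case: ifP => ?; [|case: ifP => ?]; lia.
move=> v; have [vx|vx] := boolP (x - 2 <= v <= x).
  rewrite !block // mateE // /partner.
  by move: adm; rewrite /admissible; case: ifP => ?; [|case: ifP => ?]; lia.
rewrite -[RHS]Dx; congr D; apply: val_inj; rewrite /= !mateE // /partner.
have -> : (nat_of_ord v == x - 2) = false by lia.
have -> : (nat_of_ord v == x) = false by lia.
by have -> : (v < x - 2) = (v < x) by lia.
Qed.

Lemma closed_escape (n : nat) (D : pred 'I_n) :
  odd n -> 2 < n -> (forall v, D (mate n.-1 v) = D v) -> ~ (forall v, D v) ->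
  exists x (y : 'I_n), [/\ admissible n x, x < n, near n x y, ~~ D y
    & forall v, D (mate x v) = D v].
Proof.
move=> n_odd n2 D0 Dfull.
have adm x : ~~ odd x -> 0 < x < n -> admissible n x by rewrite /admissible; lia.
have [/existsP[x /and3P[x_adm /eqfunP Dx /existsP[y /andP[yx Dy]]]]|none] :=
  boolP [exists x : 'I_n, [&& admissible n x, [forall v, D (mate x v) == D v]
    & [exists y : 'I_n, near n x y && ~~ D y]]].
  by exists x, y.
have all_near x : ~~ odd x -> 0 < x < n -> (forall v, D (mate x v) = D v) ->
    forall y : 'I_n, near n x y -> D y.
  move=> x_even x_n Dx y yx; apply: contraR none => Dy.
  have [_ ltx] := andP x_n; apply/existsP; exists (Ordinal ltx) => /=.
  rewrite adm //=; apply/andP; split; first exact/eqfunP.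
  by apply/existsP; exists y; rewrite yx.
have closed m : m.*2 + 2 < n -> forall v, D (mate (n.-1 - m.*2) v) = D v.
  elim: m => [_|m IHm mn]; first by rewrite subn0.
  have IH := IHm ltac:(lia).
  have -> : n.-1 - m.+1.*2 = n.-1 - m.*2 - 2 by lia.
  apply: mate_shift_closed => //; [apply: adm; lia | lia | ].
  by apply: all_near => //; lia.
have closedx x : ~~ odd x -> 0 < x < n -> forall v, D (mate x v) = D v.
  move=> x_even xn; have -> : x = n.-1 - (n.-1 - x)./2.*2 by lia.
  by apply: closed; lia.
(* The windows around even x cover everything: 0 is near n-1 by wrapping around, and v > 0 is near v
   rounded up to even. *)
case: Dfull => v; have ltv := ltn_ord v.
have [v0|v0] := eqVneq (nat_of_ord v) 0.
  have E : ~~ odd n.-1 by lia.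
  apply: (all_near n.-1) => //; [lia|].
  by rewrite /near prednK ?modnn ?v0 ?eqxx ?orbT //; lia.
pose x := v + odd v.
have x_even : ~~ odd x by lia.
have xn : 0 < x < n by lia.
by apply: (all_near x) => //; [exact: closedx | apply: near_below; lia].
Qed.

(** * Coloring for windows of minimal length *)

Lemma windows_coloring (n : nat) (a : {perm 'I_n}) :
  2 < n -> exists B : {set 'I_n}, forall i : 'I_n,
    (exists2 t, t < 2 + (nat_of_ord i != 0) & zn_shift i t \notin B) /\
    (exists2 t, t < 2 + (nat_of_ord i != 0) & a (zn_shift i t) \in B).
Proof.
move=> n2; pose conj x v := a (mate x (a^-1%g v)).
have conjK x : admissible n x -> involutive (conj x).
  by move=> adm v; rewrite /conj permK (mateK adm) permKV.
have [n_odd|n_even] := boolP (odd n); last first.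
  have adm : admissible n n by rewrite /admissible; lia.
  have [c [cm ca]] := bipartite_involutions (mateK adm) (conjK _ adm).
  exists [set v | c v] => i; split.
    apply: (windows_hit (P := fun v => v \notin [set v | c v]) n2 adm); last by lia.
    move=> v vn; rewrite !inE.
    by have := cm v; rewrite mate_fix // => /(_ vn); do 2 case: (c _).
  apply: (windows_hit (P := fun v => a v \in [set v | c v]) n2 adm); last by lia.
  move=> v vn; rewrite !inE; have := ca (a v).
  by rewrite /conj permK (inj_eq perm_inj) mate_fix // => /(_ vn); do 2 case: (c _).
have adm0 : admissible n n.-1 by rewrite /admissible; lia.
have n0 : 0 < n by lia.
have n1 : 1 < n by lia.
have nn : n.-1 < n by lia.
pose o0 := Ordinal n0; pose o1 := Ordinal n1; pose x0 := Ordinal nn.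
(* The edge {a_0, a_1} is dropped: it takes care of itself once a_0 is in B. *)
pose g v := if a^-1%g v < 2 then v else conj n.-1 v.
have mate_lt2 (v : 'I_n) : (mate n.-1 v < 2) = (v < 2).
  by rewrite mateE // /partner; case: ifP => ?; [|case: ifP => ?]; lia.
have gK : involutive g.
  move=> v; rewrite {2}/g; case: ifP => v2; first by rewrite /g v2.
  by rewrite /g {1}/conj permK mate_lt2 v2 conjK.
have [D [x [y [adm xn yx Dy [Dm Dg]]]]] : exists (D : pred 'I_n) x (y : 'I_n),
    [/\ admissible n x, x < n, near n x y, D (a o0) != D y
      & (forall v, D (mate x v) = D v) /\ (forall v, D (g v) = D v)].
  have x0_fix : mate n.-1 x0 = x0 by apply/eqP; rewrite mate_fix.
  have [Df Dg] := dihedral_orbit_closed (mateK adm0) gK x0_fix.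
  pose D := fconnect (@mate n n.-1 \o g) x0.
  have [Da|Da] := boolP (D (a o0)); last first.
    exists D, n.-1, x0; split=> //; first by apply: near_below => /=; lia.
    by rewrite (negPf Da) /D connect0.
  (* Both [a o0] and [a o1] are fixed by [g], but the component of [x0] has at most one such
     point. *)
  have Dfull : ~ (forall v, D v).
    move=> Dv; have /perm_inj/(congr1 val) // : a o0 = a o1.
    by apply: (dihedral_orbit_fixpoint (mateK adm0) gK x0_fix _ _ Da (Dv _));
      rewrite /g permK.
  have [x [y [adm xn yx Dy Dm]]] := @closed_escape n D n_odd n2 Df Dfull.
  by exists D, x, y; split=> //; rewrite Da (negPf Dy).
have [c [ca cy cm cg]] := separating_coloring (mateK adm) gK Dm Dg Dy.
exists [set v | c v] => i; split.
  apply: (windows_hit (P := fun v => v \notin [set v | c v]) n2 adm).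
    move=> v vn; rewrite !inE.
    by have := cm v; rewrite mate_fix // => /(_ vn); do 2 case: (c _).
  have x_gt0 : 0 < x < n by move: adm; rewrite /admissible; lia.
  have [i' [ix [t t3 yE]]] := near_shift x_gt0 yx.
  by move=> _; exists i'; split=> //; exists t; rewrite // !inE -yE.
apply: (windows_hit (P := fun v => a v \in [set v | c v]) n2 adm0).
  move=> v vn; rewrite !inE; have [v2|v2] := boolP (v < 2).
    have [->|v0] := eqVneq v o0; first by rewrite ca.
    suff -> : mate n.-1 v = o0 by rewrite ca orbT.
    apply: val_inj; move: v0; rewrite -val_eqE /= mateE // /partner => v0.
    by case: ifP => ?; [|case: ifP => ?]; lia.
  have := cg (a v); rewrite /g permK (negPf v2) /conj permK.
  by rewrite (inj_eq perm_inj) mate_fix // => /(_ vn); do 2 case: (c _).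
(* The window at risk starts at [a_{n-2}] and ends at [a_0], which is in the blue class. *)
have lt2n : n.-2 < n by lia.
move=> _; exists (Ordinal lt2n); split; first by rewrite /=; lia.
exists 2 => //; rewrite inE; suff -> : zn_shift (Ordinal lt2n) 2 = o0 by [].
by apply: val_inj => /=; rewrite (_ : n.-2 + 2 = n) ?modnn //; lia.
Qed.

Theorem theorem2p1 (n : nat) (hn : 0 < n) (a : {perm 'I_n})
    (k j : 'I_n -> nat)
    (hk : forall i : 'I_n, 0 < k i) (hj : forall i : 'I_n, 0 < j i)
    (hNA : forall i : 'I_n, nat_of_ord i <> 0 ->
       3 <= #|Nset (k i) i| /\ 3 <= #|Aset a (j i) i|)
    (hNA0 : forall i : 'I_n, nat_of_ord i = 0 ->
       2 <= #|Nset (k i) i| /\ 2 <= #|Aset a (j i) i|) :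
  exists B R : {set 'I_n},
    [/\ B != R, partition [set B; R] [set: 'I_n] &
        forall i : 'I_n, ~~ (Nset (k i) i \subset B) /\
                         ~~ (Aset a (j i) i \subset R)].
Proof.
(* The bound on [N_0] gives n > 1, so the residue 1 is nonzero and its bound gives n > 2. *)
have n2 : 2 < n.
  have [N0 _] := hNA0 (Ordinal hn) erefl.
  have n1 : 1 < n by rewrite -[n]card_ord (leq_trans N0 (max_card _)).
  have [//|N1 _] := hNA (Ordinal n1).
  by rewrite -[n]card_ord (leq_trans N1 (max_card _)).
have long i : 2 + (nat_of_ord i != 0) <= k i /\ 2 + (nat_of_ord i != 0) <= j i.
  have imsetI (T : finType) m (f : 'I_m -> T) : #|[set f t | t : 'I_m]| <= m.
    by rewrite (leq_trans (leq_imset_card _ _)) // card_ord.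
  have [iE|/eqP i0] := eqVneq (nat_of_ord i) 0.
    by have [N A] := hNA0 i iE; split; [apply: leq_trans N (imsetI _ _ _) | apply: leq_trans A (imsetI _ _ _)].
  by have [N A] := hNA i i0; split; [apply: leq_trans N (imsetI _ _ _) | apply: leq_trans A (imsetI _ _ _)].
have [B hB] := windows_coloring a n2.
have hit i : ~~ (Nset (k i) i \subset B) /\ ~~ (Aset a (j i) i \subset ~: B).
  have [[t lt_t tB] [s lt_s sB]] := hB i; have [lk lj] := long i.
  have [tk sj] : t < k i /\ s < j i by split; [exact: leq_trans lk | exact: leq_trans lj].
  split; apply/subsetPn.
    by exists (zn_shift i t) => //; apply/imsetP; exists (Ordinal tk).
  exists (a (zn_shift i s)); last by rewrite inE negbK.
  by apply/imsetP; exists (Ordinal sj).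
(* The windows at 0 show that both classes are nonempty. *)
have [[t _ tB] [s _ sB]] := hB (Ordinal hn).
have BR : B != ~: B.
  by apply: contraNneq tB => E; have := sB; rewrite {1}E inE; case/negP.
exists B, (~: B); split=> //; apply/and3P; split.
- by rewrite /cover big_setU1 /= ?big_set1 ?setUCr ?in_set1.
- apply/trivIsetP => X Y /set2P[]-> /set2P[]->; rewrite ?eqxx // => _.
    by rewrite -setI_eq0 setICr.
  by rewrite -setI_eq0 setIC setICr.
apply/negP; rewrite !inE => /orP[/eqP B0|/eqP R0].
  by rewrite -B0 inE in sB.
by move: tB; rewrite -in_setC -R0 inE.
Qed.
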